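(* For every topological space $X$, $$|X|\le nu(X)^{\kappa(X)\, sL_\theta(X)}.$$
   Context: No separation axioms are assumed. $\overline{U}$ denotes the closure of $U$ in $X$, and $\mathcal{N}_x$ denotes the family of all open neighborhoods of $x$ in $X$. The exponent $\kappa(X)\,sL_\theta(X)$ is the product of cardinals. The $\theta$-closure of $A\subset X$ is $\mathrm{cl}_\theta(A)=\{x\in X: \overline{U}\cap A\ne\emptyset \text{ for every } U\in\mathcal{N}_x\}$. $\kappa(X)$ is the smallest infinite cardinal $\kappa$ such that for each $x\in X$ there is a collection $\mathcal{V}_x$ of closed neighborhoods of $x$ (closed sets containing $x$ in their interior) with $|\mathcal{V}_x|\le\kappa$ such that for every $W\in\mathcal{N}_x$ the set $\overline{W}$ contains a member of $\mathcal{V}_x$. $sL_\theta(X)$ is the smallest infinite cardinal $\tau$ such that whenever $A\subset X$ and $\mathcal{U}$ is a family of open subsets of $X$ covering $\mathrm{cl}_\theta(A)$, there is $\mathcal{V}\subset\mathcal{U}$ with $|\mathcal{V}|\le\tau$ and $A\subset\overline{\bigcup\mathcal{V}}$. A nonempty set $M\subset X$ is finitely non-Urysohn if for every nonempty finite $F\subset M$ and every choice of open neighborhoods $U_x\in\mathcal{N}_x$ ($x\in F$), $\bigcap_{x\in F}\overline{U_x}\ne\emptyset$. The non-Urysohn number of $X$ is the cardinal $nu(X)=1+\sup\{|M|: M \text{ is a finitely non-Urysohn subset of } X\}$; it may be finite. *)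

(* Defs.v *)
From mathcomp Require Import all_boot.
From mathcomp Require Import boolp classical_sets functions cardinality.
From mathcomp Require Import filter topology.

Set Implicit Arguments.
Unset Strict Implicit.
Unset Printing Implicit Defensive.

Local Open Scope classical_set_scope.
Local Open Scope card_scope.

(* Cardinals are represented by types, compared with [#<=].  A least cardinal
   with a property [P] is thus a type satisfying [P] that embeds into every type
   satisfying [P]; it is unique up to bijection, so invariants defined by
   minimality are types chosen among the least ones.  [ex_least_cardinal] is the
   well-foundedness of cardinals, which makes these choices legitimate. *)

Definition least_cardinal (P : Type -> Prop) (K : Type) : Prop :=
  P K /\ forall L : Type, P L -> [set: K] #<= [set: L].

Lemma card_le_injective (T U : Type) (f : T -> U) :
  injective f -> [set: T] #<= [set: U].
Proof.
move=> fI; apply: (card_le_trans _ (subset_card_le (@subsetT _ (f @` setT)))).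
have : f @` [set: T] #= [set: T] by apply: inj_card_eq => x y _ _ /fI.
by rewrite card_eq_le => /andP[].
Qed.

Lemma card_leTP (T U : Type) :
  [set: T] #<= [set: U] <-> exists f : T -> U, injective f.
Proof.
split=> [/card_leP[f]|[f]]; last exact: card_le_injective.
exists (fun x => val (f (SigSub (in_setT x)))) => x y /val_inj fxy.
by have /(congr1 val) := inj (in_setT _) (in_setT _) fxy.
Qed.

Lemma sval_injective (T : Type) (P : T -> Prop) : injective (@sval T P).
Proof.
move=> [x Px] [y Py] /= xy; case: _ / xy in Py *.
by congr exist; exact: Prop_irrelevance.
Qed.

Lemma ex_family_min (I : Type) (K : I -> Type) (i0 : I) :
  exists i, forall j, [set: K i] #<= [set: K j].
Proof.
pose T := forall i, K i.
pose inj_on (A : set T) := forall i x y, A x -> A y -> x i = y i -> x = y.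
have [|A [Ainj Amax]] := @Zorn_bigcup T inj_on.
  move=> F FP Ftot i x y [B FB Bx] [C FC Cy].
  have [BC|CB] := Ftot _ _ FB FC.
    by apply: (FP _ FC) => //; exact: BC.
  by apply: (FP _ FB) => //; exact: CB.
have [[i Ai]|noi] := pselect (exists i, forall k, exists2 x, A x & x i = k).
  exists i => j.
  pose s k := sval (cid2 (Ai k)).
  have sA k : A (s k) by rewrite /s; case: cid2.
  have sK k : s k i = k by rewrite /s; case: cid2.
  apply: (@card_le_injective _ _ (fun k => s k j)) => k l kl.
  by rewrite -(sK k) -(sK l) (Ainj j _ _ (sA k) (sA l) kl).
have miss i : exists k, forall x, A x -> x i <> k.
  apply: contrapT => nk; apply: noi; exists i => k.
  apply: contrapT => nx; apply: nk; exists k => x Ax xk.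
  by apply: nx; exists x.
pose z : T := fun i => sval (cid (miss i)).
have zA i x : A x -> x i <> z i by move: x; rewrite /z; case: cid.
exfalso; apply: (Amax (A `|` [set z])).
  split; first exact: subsetUl.
  by move=> /(_ z (or_intror erefl)) /(zA i0); exact.
move=> i x y [Ax|->] [Ay|->] //; first exact: Ainj.
  by move=> /zA; exact.
by move=> /esym/zA; exact.
Qed.

Lemma ex_least_cardinal (P : Type -> Prop) :
  (exists K, P K) -> exists K, least_cardinal P K.
Proof.
move=> [K0 PK0].
pose rep (A : set K0) (L : Type) :=
  [/\ P L, [set: L] #<= [set: {x | A x}] & [set: {x | A x}] #<= [set: L]].
have repE L : P L -> [set: L] #<= [set: K0] -> exists A, rep A L.
  move=> PL /card_leTP[f fI]; exists (range f); split => //.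
    apply: (@card_le_injective _ _ (fun l => exist _ (f l) (imageT f l))).
    by move=> k l [/fI].
  pose g (x : {x | range f x}) := sval (cid2 (svalP x)).
  have gK x : f (g x) = sval x by rewrite /g; case: cid2.
  apply: (@card_le_injective _ _ g) => x y gxy.
  by apply: sval_injective; rewrite -!gK gxy.
have [A0 rA0] := repE K0 PK0 (card_lexx _).
pose I := {A : set K0 | exists L, rep A L}.
have [[A [L [PL LA AL]]] Amin] := @ex_family_min I (fun i => {x | sval i x})
  (exist _ A0 (ex_intro _ K0 rA0)).
exists L; split=> // M PM.
have [MK|KM] : [set: M] #<= [set: K0] \/ [set: K0] #<= [set: M].
  have [[] h] := @ex_family_min bool (fun b => if b then M else K0) true.
    by left; exact: (h false).
  by right; exact: (h true).
- have [B rB] := repE M PM MK.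
  have [_ _ BM] := rB.
  have AB := Amin (exist _ B (ex_intro _ M rB)).
  exact: (card_le_trans LA (card_le_trans AB BM)).
- apply: (card_le_trans LA); apply: (card_le_trans _ KM).
  by apply: (@card_le_injective _ _ (@sval K0 (fun x => A x))); exact: sval_injective.
Qed.

Section Invariants.
Variable X : topologicalType.
Implicit Types (x : X) (A M W V : set X) (U : set (set X)).

Definition theta_closure A : set X :=
  [set x | forall W, open_nbhs x W -> closure W `&` A !=set0].

Definition kappa_bound (K : Type) : Prop :=
  infinite_set [set: K] /\
  forall x, exists Vx : set (set X),
    [/\ forall V, Vx V -> closed V /\ interior V x,
        Vx #<= [set: K] &
        forall W, open_nbhs x W -> exists2 V, Vx V & V `<=` closure W].

Definition sLtheta_bound (K : Type) : Prop :=
  infinite_set [set: K] /\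
  forall A U, U `<=` open -> theta_closure A `<=` \bigcup_(W in U) W ->
    exists V : set (set X),
      [/\ V `<=` U, V #<= [set: K] & A `<=` closure (\bigcup_(W in V) W)].

Definition finitely_non_Urysohn M : Prop :=
  M !=set0 /\
  forall (F : set X) (N : X -> set X),
    finite_set F -> F !=set0 -> F `<=` M ->
    (forall x, F x -> open_nbhs x (N x)) ->
    \bigcap_(x in F) closure (N x) !=set0.

Definition finitely_non_Urysohn_bound (K : Type) : Prop :=
  forall M, finitely_non_Urysohn M -> M #<= [set: K].

Lemma infinite_sum_nat (T : Type) : infinite_set [set: T + nat].
Proof.
by apply/infiniteP; apply: (@card_le_injective _ _ (@inr T nat)) => m n [].
Qed.

Lemma card_le_sum_nat (T : Type) (A : set T) : A #<= [set: T + nat].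
Proof.
apply: (card_le_trans (subset_card_le (@subsetT _ A))).
by apply: (@card_le_injective _ _ (@inl T nat)) => a b [].
Qed.

Lemma ex_kappa : exists K, least_cardinal kappa_bound K.
Proof.
apply: ex_least_cardinal; exists (set X + nat)%type; split.
  exact: infinite_sum_nat.
move=> x; exists [set V | closed V /\ interior V x]; split=> //.
  exact: card_le_sum_nat.
move=> W Wx; exists (closure W) => //; split; first exact: closed_closure.
by apply: (interiorS (@subset_closure _ W)); exact: open_nbhs_nbhs.
Qed.

Lemma ex_sLtheta : exists K, least_cardinal sLtheta_bound K.
Proof.
apply: ex_least_cardinal; exists (set X + nat)%type; split.
  exact: infinite_sum_nat.
move=> A U Uo AU; exists U; split=> //; first exact: card_le_sum_nat.
apply: subset_trans (@subset_closure _ _) => x Ax; apply: AU => W [Wo Wx].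
by exists x; split => //; exact: subset_closure.
Qed.

Lemma ex_finitely_non_Urysohn_sup :
  exists K, least_cardinal finitely_non_Urysohn_bound K.
Proof.
by apply: ex_least_cardinal; exists X => M _; exact/subset_card_le/subsetT.
Qed.

Definition kappa : Type := sval (cid ex_kappa).

Definition sLtheta : Type := sval (cid ex_sLtheta).

Definition nu : Type := (unit + sval (cid ex_finitely_non_Urysohn_sup))%type.

Lemma kappaP : least_cardinal kappa_bound kappa.
Proof. exact: svalP. Qed.

Lemma sLthetaP : least_cardinal sLtheta_bound sLtheta.
Proof. exact: svalP. Qed.

Lemma nuP : exists2 K, least_cardinal finitely_non_Urysohn_bound K &
  nu = (unit + K)%type.
Proof. by exists (sval (cid ex_finitely_non_Urysohn_sup)) => //; exact: svalP. Qed.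

End Invariants.

(* Main.v *)
Require Import Defs.
From Stdlib Require List.
From mathcomp Require Import all_boot.
From mathcomp Require Import boolp classical_sets functions cardinality.
From mathcomp Require Import filter topology.

(** The proof is a closing-off argument.  Let [K] and [S] be the cardinals
    [kappa X] and [sLtheta X], let [N] be [nu X], and fix closed neighborhoods
    [V x k] of each point [x], indexed by [k : K], such that every closure of an
    open neighborhood of [x] contains one of them.

    If [x] lies in the theta-closure of [A], then every finite intersection of
    the sets [V x k] meets [A]; recording one point of [A] for each of them
    gives a map [a : seq K -> X] with values in [A].  Points that share the same
    [a] form a finitely non-Urysohn set, because [a] picks one point common to
    any prescribed finite choice of their neighborhoods
    ([fibre_finitely_non_Urysohn]).  Hence a point of the theta-closure is
    determined by a [K]-indexed family in [A] and an element of [N].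

    If [A] is theta-closed and misses [y], then some open [W] around [y] has a
    closure disjoint from [A], each point of [A] has a [V x k] whose interior
    misses [W], and the definition of [sLtheta] extracts [S] many of these
    interiors such that the closure of their union contains [A] but not [y]
    ([theta_closed_separation]).

    So let [A] be nonempty and closed under two kinds of operations on families
    of points indexed by [K * S]: the one enumerating the finitely non-Urysohn sets above,
    and the one choosing a point outside the closure of a union of interiors,
    whenever there is one.  The first makes [A] theta-closed; the second then
    leaves no [y] outside [A].  Hence [A] is the whole space.

    It remains to bound [A].  Instead of a recursion of length [(K * S)^+], [A]
    is taken to be the set of values of well-founded terms with [K * S]-indexed
    branching.  Such a term is determined by the labels found along finite
    paths, and there are no more than [K * S] finite paths since [K * S] is
    infinite ([infinite_square], [infinite_seq]); as there are at most
    [N^(K * S)] labels, there are at most [N^(K * S)] terms ([closing_off]). *)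

Set Implicit Arguments.
Unset Strict Implicit.
Unset Printing Implicit Defensive.

Local Open Scope classical_set_scope.
Local Open Scope card_scope.

(** * Squares of infinite cardinals *)

Lemma card_le_total (T U : Type) :
  [set: T] #<= [set: U] \/ [set: U] #<= [set: T].
Proof.
have [[] h] := @ex_family_min bool (fun b => if b then T else U) true.
  by left; exact: (h false).
by right; exact: (h true).
Qed.

Definition graph_diag (T : Type) (R : set (T * T * T)) : set T :=
  [set x | exists z, R (x, x, z)].

(** [R] is the graph of an injection from [D * D] to [D] for some [D].  This [D]
    can only be [graph_diag R], so that such graphs may be compared and glued by
    inclusion and union alone. *)
Definition square_graph (T : Type) (R : set (T * T * T)) : Prop :=
  [/\ forall x y, graph_diag R x -> graph_diag R y -> exists z, R (x, y, z),
      forall x y z, R (x, y, z) ->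
        [/\ graph_diag R x, graph_diag R y & graph_diag R z],
      forall p z z', R (p, z) -> R (p, z') -> z = z' &
      forall p p' z, R (p, z) -> R (p', z) -> p = p'].

Lemma square_graph_bigcup (T : Type) (F : set (set (T * T * T))) :
  F `<=` @square_graph T -> total_on F subset ->
  square_graph (\bigcup_(R in F) R).
Proof.
move=> Fsq Ftot.
have diagU R x : F R -> graph_diag R x ->
    graph_diag (\bigcup_(R in F) R) x by move=> FR [z Rz]; exists z, R.
have join R S p q : F R -> F S -> R p -> S q -> exists2 Q, F Q & Q p /\ Q q.
  move=> FR FS Rp Sq; case: (Ftot _ _ FR FS) => sub.
    by exists S => //; split => //; exact: sub.
  by exists R => //; split => //; exact: sub.
split.
- move=> x y [z [R FR Rx]] [w [S FS Sy]].
  have [Q FQ [Qx Qy]] := join _ _ _ _ FR FS Rx Sy.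
  have [tot _ _ _] := Fsq _ FQ.
  by have [|v Qv] := tot x y _ (ex_intro _ _ Qy); [exists z|exists v, Q].
- move=> x y z [R FR Rxyz]; have [_ rng _ _] := Fsq _ FR.
  have [dx dy dz] := rng _ _ _ Rxyz.
  by split; [exact: diagU dx|exact: diagU dy|exact: diagU dz].
- move=> p z z' [R FR Rp] [S FS Sp].
  have [Q FQ [Qx Qy]] := join _ _ _ _ FR FS Rp Sp.
  by have [_ _ fn _] := Fsq _ FQ; exact: fn Qx Qy.
- move=> p p' z [R FR Rp] [S FS Sp].
  have [Q FQ [Qx Qy]] := join _ _ _ _ FR FS Rp Sp.
  by have [_ _ _ inj] := Fsq _ FQ; exact: inj Qx Qy.
Qed.

Lemma square_graph_nat (T : Type) (e : nat -> T) : injective e ->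
  square_graph [set t | exists m n, t = (e m, e n, e (pickle (m, n)))].
Proof.
move=> eI; set R := [set t | _].
have diagE x : graph_diag R x <-> range e x.
  split=> [[z [m [n [-> _ _]]]]|[m _ <-]]; first by exists m.
  by exists (e (pickle (m, m))), m, m.
have pI : injective (pickle : nat * nat -> nat) := pcan_inj pickleK.
split.
- move=> x y /diagE[m _ <-] /diagE[n _ <-].
  by exists (e (pickle (m, n))), m, n.
- by move=> x y z [m [n [-> -> ->]]]; split; apply/diagE; eexists.
- move=> p z z' [m [n [-> ->]]] [m' [n' [/eI <- /eI <- ->]]] //.
- by move=> p p' z [m [n [-> ->]]] [m' [n' [-> /eI/pI[<- <-]]]].
Qed.

Lemma square_graph_injection (T : Type) (R : set (T * T * T)) :
  square_graph R -> exists f : {x | graph_diag R x} * {x | graph_diag R x} ->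
    {x | graph_diag R x}, injective f.
Proof.
move=> [tot rng _ inj].
have ex_f (p : {x | graph_diag R x} * {x | graph_diag R x}) :
    exists z : {x | graph_diag R x}, R (sval p.1, sval p.2, sval z).
  have [z Rz] := tot _ _ (svalP p.1) (svalP p.2).
  by have [_ _ Dz] := rng _ _ _ Rz; exists (exist _ z Dz).
have [f fR] := choice ex_f.
exists f => -[x y] [x' y'] ff; have := fR (x, y); rewrite ff => h.
by have [/sval_injective-> /sval_injective->] := inj _ _ _ h (fR (x', y')).
Qed.

(** With [D] the diagonal of [R] and [E] a disjoint copy of [D], the set
    [D `|` E] embeds into [D], by tagging with [a] or [b] inside [D * D].  Hence
    so do the new pairs over [D `|` E], and they may be sent injectively to [E],
    away from the values of [R]. *)
Lemma square_graph_extend (T : Type) (R : set (T * T * T))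
    (a b : {x | graph_diag R x})
    (g : {x | graph_diag R x} -> {x | ~ graph_diag R x}) :
  square_graph R -> a <> b -> injective g ->
  exists2 R', square_graph (R `|` R') & ~ R' `<=` R.
Proof.
move=> Rsq ab gI; have [tot rng fn inj] := Rsq.
have [f fI] := square_graph_injection Rsq.
pose D := graph_diag R; pose DT := {x | D x}.
pose E := range (fun x => sval (g x)).
have EnD x : E x -> ~ D x by move=> [y _ <-]; exact: (svalP (g y)).
(* Tag points of [D] with [a] and points of [E] with [b]. *)
have ex_i x : exists z : DT,
    (forall Dx : D x, z = f (a, exist _ x Dx)) /\
    (forall y, x = sval (g y) -> z = f (b, y)).
  have [Dx|nDx] := pselect (D x).
    exists (f (a, exist _ x Dx)); split=> [Dx'|y xy].
      by congr (f (_, _)); exact: sval_injective.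
    by exfalso; move: Dx; rewrite xy; exact: (svalP (g y)).
  have [[y yx]|ny] := pselect (exists y, x = sval (g y)).
    exists (f (b, y)); split=> // y'; rewrite yx => /sval_injective/gI -> //.
  by exists a; split=> // y xy; exfalso; apply: ny; exists y.
have [i iP] := choice ex_i.
have iI x y : (D `|` E) x -> (D `|` E) y -> i x = i y -> x = y.
  have iD z (Dz : D z) : i z = f (a, exist _ z Dz) by exact: (iP z).1.
  have iE z : i (sval (g z)) = f (b, z) by exact: (iP _).2.
  move=> [Dx|[x' _ <-]] [Dy|[y' _ <-]]; rewrite ?iE ?iD => /fI.
  - by case.
  - by case=> /ab.
  - by case=> /esym/ab.
  - by case=> ->.
pose h x y := sval (g (f (i x, i y))).
have hE x y : E (h x y) by exists (f (i x, i y)).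
have hI x y x' y' : (D `|` E) x -> (D `|` E) y -> (D `|` E) x' ->
    (D `|` E) y' -> h x y = h x' y' -> (x, y) = (x', y').
  move=> Dx Dy Dx' Dy' /sval_injective/gI/fI[].
  by move=> /iI-> // /iI-> //.
pose New : set (T * T * T) := [set t | [/\ (D `|` E) t.1.1, (D `|` E) t.1.2,
  ~ (D t.1.1 /\ D t.1.2) & t.2 = h t.1.1 t.1.2]].
have diagE x : graph_diag (R `|` New) x <-> (D `|` E) x.
  split=> [[z [Rz|[] //]]|[[z Rz]|Ex]].
  - by left; exists z.
  - by exists z; left.
  - exists (h x x); right; split => //=; [by right|by right|].
    by case=> /(EnD _ Ex).
exists New; last first.
  move=> /(_ (sval (g a), sval (g a), h (sval (g a)) (sval (g a)))) sub.
  have Ea : E (sval (g a)) by exists a.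
  apply: (EnD _ Ea); exists (h (sval (g a)) (sval (g a))).
  apply: sub; split => //=; [by right|by right|].
  by case=> /(EnD _ Ea).
split.
- move=> x y /diagE Dx /diagE Dy.
  have [[Dx1 Dy1]|nD] := pselect (D x /\ D y).
    by have [z Rz] := tot _ _ Dx1 Dy1; exists z; left.
  by exists (h x y); right.
- move=> x y z [/rng[Dx Dy Dz]|[/= Dx Dy _ ->]].
    by split; apply/diagE; left.
  by split; apply/diagE => //; right.
- move=> [x y] z z' [Rz|[/= Dx Dy nD ->]] [Rz'|[/= Dx' Dy' nD' ->]] //.
  + exact: fn Rz Rz'.
  + by have [Dx Dy _] := rng _ _ _ Rz; case: nD'.
  + by have [Dx1 Dy1 _] := rng _ _ _ Rz'; case: nD.
- move=> [x y] [x' y'] z [Rz|[/= Dx Dy nD ->]] [Rz'|[/= Dx' Dy' nD' zE]].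
  + exact: inj Rz Rz'.
  + have [_ _ Dz] := rng _ _ _ Rz; exfalso; apply: (EnD z) => //.
    by rewrite zE.
  + have [_ _ Dz] := rng _ _ _ Rz'; exfalso; exact: (EnD _ (hE x y)).
  + exact: hI.
Qed.

(** Every infinite cardinal equals its square.  A maximal square graph has a
    diagonal [D] whose complement embeds into [D], since otherwise [D] embeds
    into its complement and the graph extends; then [T] embeds into two copies
    of [D], hence into [D]. *)
Lemma infinite_square (T : Type) :
  infinite_set [set: T] -> [set: T * T] #<= [set: T].
Proof.
move=> /infiniteP/card_leTP[e eI].
pose R0 : set (T * T * T) :=
  [set t | exists m n, t = (e m, e n, e (pickle (m, n)))].
have R0sq : square_graph R0 := square_graph_nat eI.
(* Graphs are required to extend [R0]; adding it by a union makes this hold for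
   the empty chain as well. *)
have [|A [Asq Amax]] :=
    @Zorn_bigcup (T * T * T)%type (fun R => square_graph (R0 `|` R)).
  move=> F FP Ftot.
  have [[R1 FR1]|F0] := pselect (exists R, F R); last first.
    rewrite (_ : R0 `|` _ = R0) //; apply/setUidPl => p [R FR].
    by exfalso; apply: F0; exists R.
  rewrite -bigcupUr; last by exists R1.
  rewrite -(bigcup_image F (setU R0) id).
  apply: square_graph_bigcup => [_ [R FR <-]|_ _ [R FR <-] [S FS <-]].
    exact: FP.
  by have [RS|SR] := Ftot _ _ FR FS; [left|right]; exact: setUS.
set R := R0 `|` A in Asq.
pose D := graph_diag R.
pose DT := {x | D x}.
have [f fI] := square_graph_injection Asq.
have De n : D (e n) by exists (e (pickle (n, n))); left; exists n, n.
pose a : DT := exist _ _ (De 0); pose b : DT := exist _ _ (De 1).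
have ab : a <> b by case=> /eI.
have [/card_leTP[i iI]|/card_leTP[g gI]] := card_le_total {x | ~ D x} DT.
(* Tag points of [D] with [a] and the others with [b]. *)
- pose h x : DT := match pselect (D x) with
    | left Dx => f (a, exist _ x Dx)
    | right nDx => f (b, i (exist _ x nDx)) end.
  have hI : injective h.
    move=> x y; rewrite /h; case: pselect => [Dx|Dx]; case: pselect => [Dy|Dy].
    - by move=> /fI[].
    - by move=> /fI [] eq; exfalso; apply: ab; exact: sval_injective.
    - by move=> /fI [] eq; exfalso; apply: ab; exact: sval_injective.
    - by move=> /fI [] /iI[].
  apply/card_leTP; exists (fun p => sval (f (h p.1, h p.2))).
  by move=> [x y] [x' y'] /sval_injective/fI[] /hI -> /hI ->.
- have [New Nsq nNew] := square_graph_extend Asq ab gI.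
  exfalso; apply: (Amax (A `|` New)); last by rewrite setUA.
  split; first exact: subsetUl.
  by move=> sub; apply: nNew => p Np; right; apply: sub; right.
Qed.

(** Iterated pairing encodes the lists of any one length, so the length is
    recorded separately. *)
Lemma infinite_seq (T : Type) :
  infinite_set [set: T] -> [set: seq T] #<= [set: T].
Proof.
move=> Tinf; have /card_leTP[p pI] := infinite_square Tinf.
have /infiniteP/card_leTP[e eI] := Tinf.
pose fold (s : seq T) := foldr (fun x y => p (x, y)) (e 0) s.
apply/card_leTP; exists (fun s => p (e (size s), fold s)) => s s' /pI[/eI].
elim: s s' => [|x s IH] [|x' s'] //= [ss'] /pI[-> ff]; congr cons.
exact: IH.
Qed.

Lemma infinite_option (T : Type) :
  infinite_set [set: T] -> [set: option T] #<= [set: T].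
Proof.
move=> Tinf; apply: card_le_trans (infinite_seq Tinf).
by apply: (@card_le_injective _ _ seq_of_opt) => -[x|] [y|] // [->].
Qed.

(** * Surjections and exponentials *)

Lemma card_le_range (T K : Type) (A : set T) :
  A !=set0 -> A #<= [set: K] -> exists f : K -> T, range f = A.
Proof.
move=> [x0 Ax0] /ocard_geP[f].
have ex_g k : exists x,
    A x /\ forall x', A x' -> f k = Some x' -> x = x'.
  have [[x Ax fk]|nx] := pselect (exists2 x, A x & f k = Some x).
    by exists x; split=> // x' _; rewrite fk => -[].
  by exists x0; split=> // x' Ax' fk; case: nx; exists x'.
have [g gP] := choice ex_g.
exists g; apply/seteqP; split=> [_ [k _ <-]|x Ax]; first exact: (gP k).1.
have [k _ fk] : (f @` setT) (Some x) by apply: (@surj _ _ _ _ f); exists x.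
by exists k => //; exact: (gP k).2.
Qed.

Lemma injective_cancel (J T : Type) (j0 : J) (j : J -> T) :
  injective j -> exists r : T -> J, cancel j r.
Proof.
move=> jI; have ex_r t : exists r, forall s, j s = t -> s = r.
  have [[s st]|ns] := pselect (exists s, j s = t).
    by exists s => s'; rewrite -st => /jI.
  by exists j0 => s st; case: ns; exists s.
by have [r rP] := choice ex_r; exists r => s; exact/esym/rP.
Qed.

Lemma card_le_fun_dom (J T N : Type) (j0 : J) :
  [set: J] #<= [set: T] -> [set: J -> N] #<= [set: T -> N].
Proof.
move=> /card_leTP[j /(injective_cancel j0)[r rK]].
apply: (@card_le_injective _ _ (fun h : J -> N => h \o r)) => h h' hh'.
by apply/funext => x; have /= := congr1 (@^~ (j x)) hh'; rewrite rK.
Qed.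

(** This is [(N^T)^J = N^(J * T)] together with [T * T = T]. *)
Lemma card_le_fun_prod (J T N L : Type) (j0 : J) : infinite_set [set: T] ->
  [set: J] #<= [set: T] -> [set: L] #<= [set: T -> N] ->
  [set: J -> L] #<= [set: T -> N].
Proof.
move=> Tinf /card_leTP[j jI] /card_leTP[g gI].
have [t0 _] := infinite_setN0 Tinf.
apply: (@card_le_trans _ _ _ [set: J * T -> N]).
  apply: (@card_le_injective _ _ (fun h p => g (h p.1) p.2)) => h h' hh'.
  apply/funext => x; apply: gI; apply/funext => t.
  exact: (congr1 (@^~ (x, t)) hh').
apply: (card_le_fun_dom _ (j0, t0)).
apply: card_le_trans (infinite_square Tinf).
apply: (@card_le_injective _ _ (fun p => (j p.1, p.2))) => -[x t] [y u].
by move=> [/jI -> ->].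
Qed.

(** The extra argument [None] tells which summand a value comes from. *)
Lemma card_le_sum_fun (A B T N : Type) (n0 n1 : N) : n0 <> n1 ->
  infinite_set [set: T] ->
  [set: A] #<= [set: T -> N] -> [set: B] #<= [set: T -> N] ->
  [set: A + B] #<= [set: T -> N].
Proof.
move=> n01 Tinf /card_leTP[f fI] /card_leTP[g gI].
apply: card_le_trans (card_le_fun_dom _ None (infinite_option Tinf)).
pose h (u : A + B) o := match u, o with
  | inl _, None => n0 | inr _, None => n1
  | inl a, Some t => f a t | inr b, Some t => g b t end.
apply: (@card_le_injective _ _ h) => u v huv.
have uv o : h u o = h v o by rewrite huv.
case: u v {huv} uv => [a|b] [a'|b'] uv.
- by congr inl; apply: fI; apply/funext => t; exact: uv (Some t).
- by case: n01; exact: uv None.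
- by case: n01; exact: esym (uv None).
- by congr inr; apply: gI; apply/funext => t; exact: uv (Some t).
Qed.

(** * Closing off under infinitary operations *)

(** Terms over operations of arity [T], with [L] naming the operations.  [Leaf]
    is a constant that makes the type inhabited. *)
Inductive term (L T : Type) : Type :=
| Leaf
| Node (l : L) (c : T -> term L T).

Section ClosingOff.
Variables (L T X : Type) (op : L -> (T -> X) -> X) (x0 : X).

Fixpoint eval (u : term L T) : X :=
  if u is Node l c then op l (fun t => eval (c t)) else x0.

(** The label found by following the path [s] down from the root; a path that
    hits a leaf reports the leaf. *)
Fixpoint label_at (u : term L T) (s : seq T) : unit + L :=
  match u, s with
  | Leaf, _ => inl tt
  | Node l _, [::] => inr l
  | Node _ c, t :: s' => label_at (c t) s'
  end.

Lemma label_at_inj : injective label_at.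
Proof.
elim=> [|l c IH] [|l' c'] // uv; have lab s := congr1 (@^~ s) uv.
- by have := lab [::].
- by have := lab [::].
- have [->] := lab [::]; congr Node; apply/funext => t; apply: IH.
  by apply/funext => s; exact: lab (t :: s).
Qed.

(** The values of all terms form the closure.  A term is determined by its
    labels along finite paths ([label_at_inj]), and these paths are no more
    numerous than [T]. *)
Lemma closing_off (N : Type) (n0 n1 : N) : n0 <> n1 ->
  infinite_set [set: T] -> [set: L] #<= [set: T -> N] ->
  exists A : set X, [/\ A !=set0, A #<= [set: T -> N] &
    forall l a, (forall t, A (a t)) -> A (op l a)].
Proof.
move=> n01 Tinf LN; exists (range eval); split.
- by exists x0, (Leaf _ _).
- apply: (card_le_trans (card_image_le _ _)).
  apply: (@card_le_trans _ _ _ [set: seq T -> unit + L]).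
    exact: card_le_injective label_at_inj.
  apply: (card_le_fun_prod [::] Tinf (infinite_seq Tinf)).
  apply: (card_le_sum_fun n01 Tinf _ LN).
  by apply: (@card_le_injective _ _ (fun _ _ => n0)) => -[] [].
- move=> l a /(_ _)/cid2 aA; exists (Node l (fun t => sval (aA t))) => //=.
  by congr op; apply/funext => t; case: (aA t).
Qed.

End ClosingOff.

(** * Points of the theta-closure and points outside it *)

Section Topology.
Variable X : topologicalType.
Implicit Types (x y : X) (A M : set X).

Definition closed_nbhds_system (K : Type) (V : X -> K -> set X) : Prop :=
  (forall x k, closed (V x k) /\ interior (V x k) x) /\
  forall x W, open_nbhs x W -> exists k, V x k `<=` closure W.

Lemma kappa_bound_system (K : Type) : kappa_bound X K ->
  exists V : X -> K -> set X, closed_nbhds_system V.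
Proof.
move=> [_ /(_ _)/cid kb].
have ex_V x : exists V : K -> set X,
    (forall k, closed (V k) /\ interior (V k) x) /\
    forall W, open_nbhs x W -> exists k, V k `<=` closure W.
  have [Vx [Vcl VK Vsub]] := kb x.
  have [|V Vr] := card_le_range _ VK.
    have [V VV _] := Vsub _ (conj openT I : open_nbhs x setT).
    by exists V.
  exists V; split=> [k|W /Vsub]; first by apply: Vcl; rewrite -Vr; exists k.
  by rewrite -Vr => -[_ [k _ <-] kW]; exists k.
have [V VP] := choice ex_V.
by exists V; split=> [x|x W]; have [V1 V2] := VP x; [exact: V1|exact: V2].
Qed.

(** The points for which [a] is a simultaneous choice of elements of all finite
    intersections of their neighborhoods [V x k].  Lists stand for the finite
    sets of indices. *)
Definition fibre (K : Type) (V : X -> K -> set X) (a : seq K -> X) : set X :=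
  [set x | forall s k, List.In k s -> V x k (a s)].

(** A finite intersection of the sets [V x k] contains the closure of an open
    neighborhood of [x], because these sets are closed; hence it meets [A]. *)
Lemma theta_closure_fibre (K : Type) (V : X -> K -> set X) A x :
  closed_nbhds_system V -> theta_closure A x ->
  exists2 a : seq K -> X, (forall s, A (a s)) & fibre V a x.
Proof.
move=> [Vcl _] Ax.
(* Finite intersections of interiors, by induction on the list of indices. *)
have ex_W s : exists2 W, open_nbhs x W & forall k, List.In k s -> W `<=` V x k.
  elim: s => [|k s [W [Wo Wx] Wsub]].
    by exists setT => //; split => //; exact: openT.
  exists (interior (V x k) `&` W).
    split; first by apply: openI => //; exact: open_interior.
    by split=> //; exact: (Vcl x k).2.
  move=> k' [<-|/Wsub Wk'].
    by apply: subset_trans (@interior_subset _ _); exact: subIsetl.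
  exact: subset_trans (@subIsetr _ _ _) Wk'.
have ex_a s : exists z, A z /\ forall k, List.In k s -> V x k z.
  have [W Wx Wsub] := ex_W s; have [z [Wz Az]] := Ax _ Wx.
  exists z; split=> // k /Wsub WV; apply: (Vcl x k).1.
  exact: (closure_subset WV).
have [a aP] := choice ex_a; exists a => [s|s k]; first exact: (aP s).1.
exact: (aP s).2.
Qed.

(** For finitely many points [x] of the fibre, choose [k x] so that [V x (k x)]
    lies in the closure of the given neighborhood of [x]; the value of [a] at
    the list of all these [k x] belongs to every [V x (k x)]. *)
Lemma fibre_finitely_non_Urysohn (K : Type) (V : X -> K -> set X)
    (a : seq K -> X) :
  closed_nbhds_system V -> fibre V a !=set0 ->
  finitely_non_Urysohn (fibre V a).
Proof.
move=> [_ Vsub] fib0; split=> // F N /finite_seqP[s ->] _ FM Nnbhs.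
have ex_k x : exists k, x \in s -> V x k `<=` closure (N x).
  have [xs|xs] := boolP (x \in s).
    by have [k kN] := Vsub _ _ (Nnbhs x xs); exists k.
  by have [k _] := Vsub x setT (conj openT I); exists k.
have [k kP] := choice ex_k.
exists (a (map k s)) => x xs; apply: (kP x xs).
apply: (FM x xs); apply: List.in_map.
elim: s xs {FM Nnbhs ex_k kP} => //= y s IH; rewrite inE.
by case/orP=> [/eqP->|/IH]; [left|right].
Qed.

Lemma finitely_non_Urysohn_set1 x : finitely_non_Urysohn [set x].
Proof.
split=> [|F N _ _ Fx Nnbhs]; first by exists x.
exists x => y Fy; have /= yx := Fx y Fy; rewrite -yx.
by apply: subset_closure; have [] := Nnbhs y Fy.
Qed.

(** As [y] is not in the theta-closure of [A], it has an open neighborhood [W]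
    whose closure is disjoint from [A].  The complement [O] of this closure is
    an open set containing [A], and the closure of [O] is disjoint from [W]; so
    each [x] in [A] has some [V x k] contained in the closure of [O], hence
    disjoint from [W].  The interiors of these sets cover the theta-closure of
    [A].

    The [S] interiors obtained are presented by a family of points and a set [B]
    of indices, instead of a family of pairs in [X * K], so that an operation on
    points with label [B] can read them. *)
Lemma theta_closed_separation (K S : Type) (V : X -> K -> set X) A y :
  closed_nbhds_system V -> sLtheta_bound X S ->
  A !=set0 -> theta_closure A `<=` A -> ~ A y ->
  exists (a : S -> X) (B : set (K * S)), [/\ forall t, A (a t),
    A `<=` closure (\bigcup_(p in B) interior (V (a p.2) p.1)) &
    ~ closure (\bigcup_(p in B) interior (V (a p.2) p.1)) y].
Proof.
move=> [Vcl Vsub] [_ Ssub] [x0 Ax0] Acl Ay.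
have [W [Wo Wy] WA] : exists2 W, open_nbhs y W & closure W `&` A = set0.
  apply: contrapT => nW; apply: Ay; apply: Acl => W Wy; apply/set0P/eqP => WA.
  by apply: nW; exists W.
pose U : set (set X) := [set O | exists x k,
  [/\ A x, O = interior (V x k) & O `&` W = set0]].
have [|x /Acl Ax|Q [QU QS AQ]] := Ssub A U.
- by move=> _ [x [k [_ -> _]]]; exact: open_interior.
- have Ox : open_nbhs x (~` closure W).
    split; first exact/closed_openC/closed_closure.
    by move=> Wx; have : (closure W `&` A) x by []; rewrite WA.
  have [k kW] := Vsub _ _ Ox.
  exists (interior (V x k)); last exact: (Vcl x k).2.
  exists x, k; split=> //; rewrite -subset0 => z [/interior_subset/kW clz Wz].
  have [z' [nWz' Wz']] := clz W (open_nbhs_nbhs (conj Wo Wz)).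
  by apply: nWz'; exact: subset_closure.
have Q0 : Q !=set0.
  have [z [[O QO _] _]] := AQ _ Ax0 setT filterT.
  by exists O.
have [r rQ] := card_le_range Q0 QS.
have ex_xk t : exists xk : X * K,
    [/\ A xk.1, r t = interior (V xk.1 xk.2) & r t `&` W = set0].
  have [x [k h]] : U (r t) by apply: QU; rewrite -rQ; exists t.
  by exists (x, k).
have [xk xkP] := choice ex_xk.
exists (fun t => (xk t).1), [set p | p.1 = (xk p.2).2].
have -> : \bigcup_(p in [set p : K * S | p.1 = (xk p.2).2])
    interior (V (xk p.2).1 p.1) = \bigcup_(O in Q) O.
  rewrite -rQ bigcup_image; apply/seteqP; split=> z.
    by move=> [[k t] /= -> Vz]; exists t => //; have [_ -> _] := xkP t.
  move=> [t _ rz]; exists ((xk t).2, t) => //=.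
  by have [_ <- _] := xkP t.
split=> //; first by move=> t; have [] := xkP t.
move=> /(_ W (open_nbhs_nbhs (conj Wo Wy)))[z [[O QO Oz] Wz]].
have [x [k [_ _ OW]]] := QU _ QO.
by have : (O `&` W) z by []; rewrite OW.
Qed.

End Topology.

Theorem theorem6p8 (X : topologicalType) :
  [set: X] #<= [set: (kappa X * sLtheta X)%type -> nu X].
Proof.
have [[x0]|X0] := pselect (inhabited X); last first.
  have noX (x : X) : False by apply: X0.
  apply: (@card_le_injective _ _ (fun x => False_rect _ (noX x))) => x.
  by case: (noX x).
have [[kb _] [sb _] [M [Mb _] nuE]] := And3 (kappaP X) (sLthetaP X) (nuP X).
have [V Vsys] := kappa_bound_system kb.
set K := kappa X in kb V Vsys *; set S := sLtheta X in sb *.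
have Kinf := kb.1; have Sinf := sb.1.
have ex_e (F : set X) : exists e : nu X -> X,
    finitely_non_Urysohn F -> F `<=` range e.
  have [[F0 FU]|nF] := pselect (finitely_non_Urysohn F); last first.
    by exists (fun=> x0).
  have [f fF] := card_le_range F0 (Mb _ (conj F0 FU)).
  rewrite nuE; exists (fun u => if u is inr m then f m else x0) => _ x.
  by rewrite -fF => -[m _ <-]; exists (inr m).
have [e eP] := choice ex_e.
(* The added unit and an element counting a singleton; these two values encode
   subsets of [K * S] as maps to [nu X]. *)
have [n0 [n1 n01]] : exists n0 n1 : nu X, n0 <> n1.
  have [|f fx] := card_le_range _ (Mb _ (finitely_non_Urysohn_set1 x0)).
    by exists x0.
  have [m _ _] : range f x0 by rewrite fx.
  by rewrite nuE; exists (inl tt), (inr m).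
have [k0 _] := infinite_setN0 Kinf.
have [t0 _] := infinite_setN0 Sinf.
have K_KS : [set: K] #<= [set: K * S].
  by apply: (@card_le_injective _ _ (fun k => (k, t0))) => k l [].
have KSinf : infinite_set [set: K * S].
  by apply/infiniteP; apply: card_le_trans K_KS; exact/infiniteP.
have /card_leTP[j jI] := card_le_trans (infinite_seq Kinf) K_KS.
have [r rK] := injective_cancel [::] jI.
(* The labels [inl n] enumerate fibres; the labels [inr b] choose a point
   outside the closure of the union of the interiors that [b] selects, or [x0]
   when that closure is everything. *)
pose op (l : nu X + (K * S -> nu X)) (a : K * S -> X) : X := match l with
  | inl n => e (fibre V (a \o j)) n
  | inr b => xget x0 (~` closure
      (\bigcup_(p in [set p | b p = n0]) interior (V (a p) p.1)))
  end.
have [|A [A0 Acard Aop]] := @closing_off _ _ _ op x0 _ n0 n1 n01 KSinf.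
  apply: (card_le_sum_fun n01 KSinf _ (card_lexx _)).
  apply: (@card_le_injective _ _ (fun n _ => n)) => n n' nn'.
  exact: (congr1 (@^~ (k0, t0)) nn').
have Acl : theta_closure A `<=` A.
  move=> x /(theta_closure_fibre Vsys)[a aA ax].
  have fibE : fibre V ((a \o r) \o j) = fibre V a.
    by congr fibre; apply/funext => s /=; rewrite rK.
  have fibU := fibre_finitely_non_Urysohn Vsys (ex_intro _ x ax).
  have [n _ <-] := eP _ fibU _ ax.
  by have := Aop (inl n) (a \o r) (fun t => aA _); rewrite /= fibE.
apply: card_le_trans Acard; apply: subset_card_le => y _.
apply: contrapT => Ay.
have [a [B [aA AB By]]] := theta_closed_separation Vsys sb A0 Acl Ay.
pose b p := if pselect (B p) then n0 else n1.
have bE : [set p | b p = n0] = B.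
  apply/seteqP; split=> p; rewrite /b /=; case: pselect => //.
  by move=> _ /esym.
have := Aop (inr b) (a \o snd) (fun t => aA _); rewrite /= bE.
case: xgetP => [z _ nz /AB //|nC]; by case: (nC y).
Qed.
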